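(* Let $(X,D,P)$ be a complete perturbed metric space with exact metric $d=D-P$, and let $M\ge 1$ be a constant such that $D(x,y)\le M\,d(x,y)$ for all $x,y\in X$. Let $T:X\to X$ satisfy $$D(Tx,Ty)\le\lambda\,D(x,y),\qquad x,y\in X,$$ for some $\lambda\in[0,1)$ with $M\lambda<1$. Then $T$ has a unique fixed point, and for every $x_0\in X$ the Picard iteration $x_{n+1}=Tx_n$ converges to it in $(X,d)$.
   Context: A perturbed metric space $(X,D,P)$ consists of a nonempty set $X$ and two functions $D,P:X\times X\to[0,\infty)$ such that $d(x,y):=D(x,y)-P(x,y)$ is a metric on $X$, called the exact metric. Neither $D$ nor $P$ is assumed symmetric. $(X,D,P)$ is called complete if the metric space $(X,d)$ is complete. *)

(* Defs.v *)
From HB Require Import structures.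
From mathcomp Require Import all_boot all_order all_algebra.
From mathcomp Require Import all_classical all_reals all_analysis.

Set Implicit Arguments.
Unset Strict Implicit.
Unset Printing Implicit Defensive.

Import Order.TTheory GRing.Theory Num.Theory.

Local Open Scope classical_set_scope.
Local Open Scope ring_scope.

Definition is_metric (R : realType) (X : Type) (d : X -> X -> R) : Prop :=
  [/\ forall x y, 0 <= d x y,
      forall x y, d x y = 0 <-> x = y,
      forall x y, d x y = d y x &
      forall x y z, d x z <= d x y + d y z].

(* [pmD] and [pmP] are not assumed symmetric. *)
Record perturbedMetricSpace (R : realType) := PerturbedMetricSpace {
  pm_carrier :> Type ;
  pmD : pm_carrier -> pm_carrier -> R ;
  pmP : pm_carrier -> pm_carrier -> R ;
  pm_nonempty : inhabited pm_carrier ;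
  pmD_ge0 : forall x y, 0 <= pmD x y ;
  pmP_ge0 : forall x y, 0 <= pmP x y ;
  pm_metric : is_metric (fun x y => pmD x y - pmP x y)
}.

Section exact_metric.
Context {R : realType} {S : perturbedMetricSpace R}.

Definition exact_metric (x y : S) : R := pmD x y - pmP x y.

Lemma exact_metricxx (x : S) : exact_metric x x = 0.
Proof. by case: (pm_metric S) => _ d0 _ _; exact/d0. Qed.

Lemma exact_metric_positivity (x y : S) : exact_metric x y = 0 -> x = y.
Proof. by case: (pm_metric S) => _ d0 _ _ /d0. Qed.

Lemma exact_metric_sym (x y : S) : exact_metric x y = exact_metric y x.
Proof. by case: (pm_metric S) => _ _ dC _; apply: dC. Qed.

Lemma exact_metric_triangle (y x z : S) :
  exact_metric x z <= exact_metric x y + exact_metric y z.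
Proof. by case: (pm_metric S) => _ _ _ dD; apply: dD. Qed.

End exact_metric.

(* The carrier is the metric space (X, d): its topology and uniformity, hence
   the library's [-->] and [cauchy], are those of the exact metric. *)
HB.instance Definition _ (R : realType) (S : perturbedMetricSpace R) :=
  gen_eqMixin (pm_carrier S).
HB.instance Definition _ (R : realType) (S : perturbedMetricSpace R) :=
  gen_choiceMixin (pm_carrier S).
HB.instance Definition _ (R : realType) (S : perturbedMetricSpace R) :=
  isMetric.Build R (pm_carrier S) (@exact_metricxx R S)
    (@exact_metric_positivity R S) (@exact_metric_sym R S)
    (@exact_metric_triangle R S).

Lemma mdist_exact (R : realType) (S : perturbedMetricSpace R) (x y : S) :
  mdist x y = exact_metric x y.
Proof. by []. Qed.

(* Sequential completeness; the library's [completeType] quantifies over proper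
   Cauchy filters instead. *)
Definition pm_complete (R : realType) (S : perturbedMetricSpace R) : Prop :=
  forall u : nat -> S, cauchy (u @ \oo) -> exists l : S, u @ \oo --> l.

(* Main.v *)
Require Import Defs.
From mathcomp Require Import all_boot all_order all_algebra.
From mathcomp Require Import all_classical all_reals all_analysis.
From mathcomp Require Import lra.

(* Since 0 <= P and D <= M d, the exact metric is equivalent to D: d <= D <= M d.
   Hence d(Tx, Ty) <= D(Tx, Ty) <= lambda D(x, y) <= M lambda d(x, y), so T is a
   contraction of (X, d) and Banach's fixed point theorem applies. *)

Import Order.TTheory GRing.Theory Num.Theory.
Import metricType_numDomainType.

Local Open Scope classical_set_scope.
Local Open Scope ring_scope.

Section banach_fixed_point.
Context {R : realType} {X : metricType R} {k : R} {f : X -> X}.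
Hypotheses (k_ge0 : 0 <= k) (k_lt1 : k < 1).
Hypothesis f_lip : forall x y, mdist (f x) (f y) <= k * mdist x y.

Lemma near_geometric_lt (c e : R) : 0 < e -> \forall n \near \oo, c * k ^+ n < e.
Proof.
move=> e0; have k1 : `|k| < 1 by rewrite ger0_norm.
by apply: cvgr_lt e0; exact: (@cvg_geometric R c k).
Qed.

Lemma mdist_iter_contraction (n : nat) (x y : X) :
  mdist (iter n f x) (iter n f y) <= mdist x y * k ^+ n.
Proof.
elim: n => [|n IHn] /=; first by rewrite expr0 mulr1.
by rewrite (le_trans (f_lip _ _))// exprS mulrCA ler_wpM2l.
Qed.

(** Replaces the sum of a geometric series: with [a n] the distance from [x] to its [n]-th iterate,
    the triangle inequality through [f x] gives [a n.+1 <= a 1 + k * a n], and [a 1 / (1 - k)] is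
    the fixed point of this recursion. *)
Lemma mdist_orbit (n : nat) (x : X) :
  mdist x (iter n f x) <= mdist x (f x) / (1 - k).
Proof.
rewrite ler_pdivlMr ?subr_gt0//; elim: n => [|n IHn].
  by rewrite /= mdistxx mul0r mdist_ge0.
have step : mdist x (iter n.+1 f x) <= mdist x (f x) + k * mdist x (iter n f x).
  by rewrite (le_trans (metric_triangle _ (f x) _))// lerD2l f_lip.
have := ler_wpM2l k_ge0 IHn.
have : 0 <= 1 - k by rewrite subr_ge0 ltW.
(* [step] times [1 - k], plus [k] times the induction hypothesis; the remaining products serve as
   atoms. *)
move/(fun k1 => ler_wpM2r k1 step); lra.
Qed.

(** For [N <= n], the iterates [N] and [n] are the images under [iter N f] of [x] and of a point of
    its orbit. Their distance is thus at most [k ^+ N] times the orbit bound, uniformly in [n]. *)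
Lemma cauchy_iter_contraction (x : X) : cauchy (iter n f x @[n --> \oo]).
Proof.
apply: cauchy_exP => e e0.
have [N _ small] := near_geometric_lt (mdist x (f x) / (1 - k)) _ e0.
exists (iter N f x); exists N => // n /= leNn.
rewrite ballEmdist /= -(subnKC leNn) iterD.
apply: le_lt_trans (small N (leqnn N)).
rewrite (le_trans (mdist_iter_contraction _ _ _))//.
by rewrite ler_wpM2r ?exprn_ge0 ?mdist_orbit.
Qed.

(** The shifted orbit tends to [p] as a tail of the orbit, and to [f p] because [f] does not
    increase distances; limits are unique. *)
Lemma contraction_lim_fixed (x p : X) :
  iter n f x @[n --> \oo] --> p -> f p = p.
Proof.
move=> xp; apply: (@cvg_unique _ (@metric_hausdorff _ X)
  (iter (n + 1) f x @[n --> \oo])); last exact: cvg_comp (cvg_addnr 1) xp.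
apply/cvgrPdist_lt => e e0.
apply: filterS (cvgr_dist_lt xp e0) => n.
apply: le_lt_trans; rewrite addn1.
by rewrite (le_trans (f_lip _ _))// ler_piMl ?mdist_ge0 ?ltW.
Qed.

Lemma contraction_fixed_unique (p q : X) : f p = p -> f q = q -> q = p.
Proof.
move=> fp fq; apply/eqP/negPn; rewrite -mdist_gt0; apply/negP => qp.
by have := f_lip q p; rewrite fp fq ler_pMl// leNgt k_lt1.
Qed.

Lemma contraction_iter_cvg (p x : X) :
  f p = p -> iter n f x @[n --> \oo] --> p.
Proof.
move=> fp; apply/cvgrPdist_lt => e e0.
apply: filterS (near_geometric_lt (mdist p x) _ e0) => n.
(* The fixed point is its own [n]-th iterate, so two orbits are being compared. *)
by apply: le_lt_trans; rewrite -{1}(iter_fix n fp) mdist_iter_contraction.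
Qed.

End banach_fixed_point.

Lemma exact_metric_le_D (R : realType) (S : perturbedMetricSpace R) (x y : S) :
  exact_metric x y <= pmD x y.
Proof. by rewrite lerBlDr lerDl pmP_ge0. Qed.

Theorem corollary3p9 (R : realType) (S : perturbedMetricSpace R) (M lambda : R)
    (T : S -> S) :
  pm_complete S ->
  1 <= M ->
  (forall x y : S, pmD x y <= M * exact_metric x y) ->
  0 <= lambda < 1 ->
  M * lambda < 1 ->
  (forall x y : S, pmD (T x) (T y) <= lambda * pmD x y) ->
  exists p : S,
    [/\ T p = p,
        forall q : S, T q = q -> q = p &
        forall x0 : S, iter n T x0 @[n --> \oo] --> p].
Proof.
move=> complete M1 DM /andP[l0 _] Ml1 TD.
have Ml0 : 0 <= M * lambda by rewrite mulr_ge0// (le_trans _ M1).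
have T_lip (x y : S) : mdist (T x) (T y) <= M * lambda * mdist x y.
  rewrite !mdist_exact (le_trans (exact_metric_le_D _ _ _ _))//.
  by rewrite (le_trans (TD x y))// (mulrC M) -mulrA ler_wpM2l.
(* Completeness is applied to a single orbit; all others are then attracted to its limit. *)
have [x0] := pm_nonempty S.
have [p x0p] := complete _ (cauchy_iter_contraction Ml0 Ml1 T_lip x0).
have Tp := contraction_lim_fixed Ml1 T_lip _ _ x0p.
exists p; split=> // [q Tq|x].
  exact: contraction_fixed_unique Ml1 T_lip _ _ Tp Tq.
exact: contraction_iter_cvg Ml0 Ml1 T_lip _ _ Tp.
Qed.
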